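(* Let $(\mathfrak{g},[\cdot,\cdot]_{\mathfrak{g}},B_{\mathfrak{g}})$ be an $n$-dimensional quadratic Lie algebra over $\mathbb{F}$, let $V$ be an $r$-dimensional vector space and let $(\mathfrak{G},[\cdot,\cdot]_{\mathfrak{G}})$ be a central extension of $(\mathfrak{g},[\cdot,\cdot]_{\mathfrak{g}})$ by $V$. Suppose there exists an invariant metric $B_{\mathfrak{G}}$ on $(\mathfrak{G},[\cdot,\cdot]_{\mathfrak{G}})$. (i) If $V$ is non-degenerate (i.e. $V\cap V^{\perp}=\{0\}$), there exists an invariant metric $\bar{B}_{\mathfrak{g}}$ on $(\mathfrak{g},[\cdot,\cdot]_{\mathfrak{g}})$ such that $(\mathfrak{G},[\cdot,\cdot]_{\mathfrak{G}},B_{\mathfrak{G}})$ is isometric to the orthogonal direct sum $(\mathfrak{g},[\cdot,\cdot]_{\mathfrak{g}},\bar{B}_{\mathfrak{g}})\overset{\perp}{\oplus}(V,B_{\mathfrak{G}}|_{V\times V})$, where $V$ is Abelian. (ii) If $V$ is isotropic (i.e. $V\subseteq V^{\perp}$), then: (a) $r\le \dim_{\mathbb{F}}C(\mathfrak{g})$, where $C(\mathfrak{g})$ is the center of $\mathfrak{g}$; (b) there is an $(n-r)$-dimensional quadratic Lie algebra $(\mathfrak{h},[\cdot,\cdot]_{\mathfrak{h}},B_{\mathfrak{h}})$ and an $r$-dimensional vector space $\mathfrak{a}$ such that $\mathfrak{G}=\mathfrak{a}\oplus\mathfrak{h}\oplus V$ and $(\mathfrak{G},[\cdot,\cdot]_{\mathfrak{G}},B_{\mathfrak{G}})$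 is a double central extension of $(\mathfrak{h},[\cdot,\cdot]_{\mathfrak{h}},B_{\mathfrak{h}})$ by $\mathfrak{a}$, where $\mathfrak{a}^{*}$ and $V$ are isomorphic vector spaces; (c) there exists a quadratic Lie algebra structure on the vector space $\mathfrak{a}\oplus\mathfrak{h}$ such that $(\mathfrak{g},[\cdot,\cdot]_{\mathfrak{g}},B_{\mathfrak{g}})=(\mathfrak{a}\oplus\mathfrak{h},[\cdot,\cdot]_{\mathfrak{a}\oplus\mathfrak{h}},B_{\mathfrak{a}\oplus\mathfrak{h}})$ and $[\mathfrak{g},\mathfrak{g}]_{\mathfrak{g}}\subseteq\mathfrak{h}$.
   Context: All Lie algebras are finite-dimensional over an algebraically closed field $\mathbb{F}$ of characteristic zero. An invariant metric on a Lie algebra $\mathfrak{g}$ is a non-degenerate symmetric bilinear form $B_{\mathfrak{g}}$ with $B_{\mathfrak{g}}(x,[y,z]_{\mathfrak{g}})=B_{\mathfrak{g}}([x,y]_{\mathfrak{g}},z)$ for all $x,y,z$; a quadratic Lie algebra is a Lie algebra with an invariant metric. An isometry of quadratic Lie algebras is a Lie algebra isomorphism preserving the metrics. A 2-cocycle of $\mathfrak{g}$ with values in a vector space $V$ is a skew-symmetric bilinear map $\theta:\mathfrak{g}\times\mathfrak{g}\to V$ with $\theta(x,[y,z]_{\mathfrak{g}})+\theta(y,[z,x]_{\mathfrak{g}})+\theta(z,[x,y]_{\mathfrak{g}})=0$. The central extension of $\mathfrak{g}$ by $V$ associated to $\theta$ is the vector space $\mathfrak{G}=\mathfrak{g}\oplus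 V$ with bracket $[x+u,y+v]_{\mathfrak{G}}=[x,y]_{\mathfrak{g}}+\theta(x,y)$ for $x,y\in\mathfrak{g}$, $u,v\in V$; $V$ is called the kernel of the extension. For a subspace of $\mathfrak{G}$, $\perp$ is taken with respect to $B_{\mathfrak{G}}$. Double central extension. Let $(\mathfrak{h},[\cdot,\cdot]_{\mathfrak{h}},B_{\mathfrak{h}})$ be a quadratic Lie algebra and $\mathfrak{a}$ a finite-dimensional vector space. Suppose given a linear map $\phi$ from $\mathfrak{a}$ to the space of $B_{\mathfrak{h}}$-skew-symmetric derivations of $\mathfrak{h}$, and skew-symmetric bilinear maps $\Psi:\mathfrak{a}\times\mathfrak{a}\to\mathfrak{h}$ and $\omega:\mathfrak{a}\times\mathfrak{a}\to\mathfrak{a}^{*}$. Define $\Phi:\mathfrak{h}\times\mathfrak{h}\to\mathfrak{a}^*$ by $\Phi(x,y)(a)=B_{\mathfrak{h}}(\phi(a)(x),y)$ and $\chi:\mathfrak{a}\times\mathfrak{h}\to\mathfrak{a}^*$ by $\chi(a,x)(b)=-B_{\mathfrak{h}}(\Psi(a,b),x)$. Assume that for all $a,b,c\in\mathfrak{a}$: $\phi(a)\phi(b)-\phi(b)\phi(a)=\operatorname{ad}_{\mathfrak{h}}(\Psi(a,b))$; $\phi(a)(\Psi(b,c))+\phi(b)(\Psi(c,a))+\phi(c)(\Psi(a,b))=0$; $\chi(a,\Psi(b,c))+\chi(b,\Psi(c,a))+\chi(c,\Psi(a,b))=0$; $\omega(a,b)(c)=\omega(b,c)(a)$. The double central extension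 of $\mathfrak{h}$ by $\mathfrak{a}$ (for the data $\phi,\Psi,\omega$) is the quadratic Lie algebra $\mathfrak{a}\oplus\mathfrak{h}\oplus\mathfrak{a}^{*}$ with bracket $[a,b]=\Psi(a,b)+\omega(a,b)$, $[a,x]=\phi(a)(x)+\chi(a,x)$, $[x,y]=[x,y]_{\mathfrak{h}}+\Phi(x,y)$, and $[\alpha,\cdot]=0$, for $a,b\in\mathfrak{a}$, $x,y\in\mathfrak{h}$, $\alpha\in\mathfrak{a}^*$, and invariant metric $B(a+x+\alpha,b+y+\beta)=B_{\mathfrak{h}}(x,y)+\beta(a)+\alpha(b)$. *)

(* Defs.v *)
From HB Require Import structures.
From mathcomp Require Import all_boot all_order all_algebra.
From mathcomp Require Import ring.

Set Implicit Arguments.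
Unset Strict Implicit.
Unset Printing Implicit Defensive.

Import GRing.Theory.
Local Open Scope ring_scope.

(* Skew-symmetry is stated as [x, y] = - [y, x]; in characteristic different
   from 2 this is equivalent to [x, x] = 0. *)
Record lie_bracket (F : fieldType) (L : vectType F) := LieBracket {
  lie_fun :> {bilinear L -> L -> L};
  lie_skew : forall x y, lie_fun x y = - lie_fun y x;
  lie_jacobi : forall x y z,
    lie_fun x (lie_fun y z) + lie_fun y (lie_fun z x)
      + lie_fun z (lie_fun x y) = 0 }.

Definition invariant_metric (F : fieldType) (L : vectType F)
    (br : lie_bracket L) (B : {symmetric L}) : Prop :=
  nondegenerate B /\ (forall x y z, B x (br y z) = B (br x y) z).

Definition lie_isometry (F : fieldType) (L1 L2 : vectType F)
    (br1 : lie_bracket L1) (B1 : {symmetric L1})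
    (br2 : lie_bracket L2) (B2 : {symmetric L2}) (f : L1 -> L2) : Prop :=
  [/\ linear f, bijective f, {morph f : x y / br1 x y >-> br2 x y}
    & isometry B2 B1 f].

Section Subspaces.
Variables (F : fieldType) (L : vectType F) (br : lie_bracket L).

Definition lie_center : {vspace L} :=
  lker (linfun (fun x : L => linfun (br x))).

Lemma mem_lie_center x :
  reflect (forall y, br x y = 0) (x \in lie_center).
Proof.
have lin : linear (fun x : L => linfun (br x)).
  move=> c u v; apply/lfunP => y.
  by rewrite add_lfunE scale_lfunE !lfunE /= linearPl.
pose flin := GRing.isLinear.Build _ _ _ _ _ lin.
pose f : {linear L -> 'End(L)} := HB.pack (fun x : L => linfun (br x)) flin.
rewrite memv_ker (lfunE f) /=; apply: (iffP eqP) => [/lfunP e y | e].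
  by have := e y; rewrite zero_lfunE lfunE /=.
by apply/lfunP => y; rewrite zero_lfunE lfunE; apply: e.
Qed.

Definition derived_algebra : {vspace L} :=
  <<[seq br x y | x <- vbasis {:L}, y <- vbasis {:L}]>>%VS.

Lemma derived_algebraP (U : {vspace L}) :
  reflect (forall x y, br x y \in U) (derived_algebra <= U)%VS.
Proof.
apply: (iffP span_subvP) => [sU x y | inU _ /allpairsP[p [_ _ ->]]] //.
rewrite (coord_vbasis (memvf x)) (coord_vbasis (memvf y)).
rewrite linear_sumlz rpred_sum // => i _.
rewrite linear_sumr rpred_sum // => j _.
rewrite linearZl_LR linearZr_LR !rpredZ //.
by apply/sU/allpairs_f; rewrite mem_nth ?size_tuple.
Qed.

End Subspaces.

Section AbelianBracket.
Variables (F : fieldType) (V : vectType F).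

Definition zero_bracket (_ _ : V) : V := 0.

Fact zero_bracket_bilinear : bilinear_for
  (GRing.Scale.Law.clone _ _ *:%R _) (GRing.Scale.Law.clone _ _ *:%R _)
  zero_bracket.
Proof. by split=> ? ? ? ?; rewrite /zero_bracket /= scaler0 addr0. Qed.
HB.instance Definition _ :=
  bilinear_isBilinear.Build F V V V _ _ zero_bracket zero_bracket_bilinear.

Fact abelian_skew x y : zero_bracket x y = - zero_bracket y x.
Proof. by rewrite /zero_bracket oppr0. Qed.
Fact abelian_jacobi x y z :
  zero_bracket x (zero_bracket y z) + zero_bracket y (zero_bracket z x)
    + zero_bracket z (zero_bracket x y) = 0.
Proof. by rewrite /zero_bracket !addr0. Qed.

Definition abelian_bracket : lie_bracket V :=
  @LieBracket F V zero_bracket abelian_skew abelian_jacobi.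

End AbelianBracket.

Section DirectSum.
Variables (F : fieldType) (L1 L2 : vectType F).

Section Bracket.
Variables (br1 : lie_bracket L1) (br2 : lie_bracket L2).

Definition dsum_fun (s t : L1 * L2) : L1 * L2 := (br1 s.1 t.1, br2 s.2 t.2).

Fact dsum_fun_bilinear : bilinear_for
  (GRing.Scale.Law.clone _ _ *:%R _) (GRing.Scale.Law.clone _ _ *:%R _)
  dsum_fun.
Proof.
by split=> u c s t; rewrite /dsum_fun /= ?linearPl ?linearPr.
Qed.
HB.instance Definition _ := bilinear_isBilinear.Build F
  (L1 * L2)%type (L1 * L2)%type (L1 * L2)%type _ _ dsum_fun dsum_fun_bilinear.

Fact dsum_skew s t : dsum_fun s t = - dsum_fun t s.
Proof. by rewrite /dsum_fun lie_skew [br2 _ _]lie_skew. Qed.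
Fact dsum_jacobi s t u :
  dsum_fun s (dsum_fun t u) + dsum_fun t (dsum_fun u s)
    + dsum_fun u (dsum_fun s t) = 0.
Proof. by congr pair; apply: lie_jacobi. Qed.

Definition dsum_bracket : lie_bracket (L1 * L2)%type :=
  @LieBracket F (L1 * L2)%type dsum_fun dsum_skew dsum_jacobi.
End Bracket.

Section Form.
Variables (B1 : {symmetric L1}) (B2 : {symmetric L2}).

Definition dsum_form (s t : L1 * L2) : F := B1 s.1 t.1 + B2 s.2 t.2.

Fact dsum_form_bilinear : bilinear_for
  (GRing.Scale.Law.clone _ _ *%R _) (GRing.Scale.Law.clone _ _ *%R _)
  dsum_form.
Proof.
split=> u c s t; rewrite /dsum_form /=.
  by rewrite !linearPl /=; ring.
by rewrite !linearPr /=; ring.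
Qed.
HB.instance Definition _ := bilinear_isBilinear.Build F
  (L1 * L2)%type (L1 * L2)%type F _ _ dsum_form dsum_form_bilinear.
Fact dsum_form_sym s t : dsum_form s t = (-1) ^+ false * idfun (dsum_form t s).
Proof. by rewrite /dsum_form hermC [B2 _ _]hermC /=; ring. Qed.
HB.instance Definition _ := isHermitianSesquilinear.Build F
  (L1 * L2)%type false idfun dsum_form dsum_form_sym.
End Form.

End DirectSum.

Record cocycle (F : fieldType) (g V : vectType F) (br : lie_bracket g) :=
  Cocycle {
    cocycle_fun :> {bilinear g -> g -> V};
    cocycle_skew : forall x y, cocycle_fun x y = - cocycle_fun y x;
    cocycle_cyclic : forall x y z,
      cocycle_fun x (br y z) + cocycle_fun y (br z x)
        + cocycle_fun z (br x y) = 0 }.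

Section CentralExtension.
Variables (F : fieldType) (g V : vectType F).

Section Bracket.
Variables (br : lie_bracket g) (theta : cocycle V br).

Definition cext_fun (s t : g * V) : g * V := (br s.1 t.1, theta s.1 t.1).

Fact cext_fun_bilinear : bilinear_for
  (GRing.Scale.Law.clone _ _ *:%R _) (GRing.Scale.Law.clone _ _ *:%R _)
  cext_fun.
Proof. by split=> u c s t; rewrite /cext_fun /= ?linearPl ?linearPr. Qed.
HB.instance Definition _ := bilinear_isBilinear.Build F
  (g * V)%type (g * V)%type (g * V)%type _ _ cext_fun cext_fun_bilinear.

Fact cext_skew s t : cext_fun s t = - cext_fun t s.
Proof. by rewrite /cext_fun lie_skew cocycle_skew. Qed.
Fact cext_jacobi s t u :
  cext_fun s (cext_fun t u) + cext_fun t (cext_fun u s)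
    + cext_fun u (cext_fun s t) = 0.
Proof. by congr pair; [apply: lie_jacobi | apply: cocycle_cyclic]. Qed.

Definition central_extension : lie_bracket (g * V)%type :=
  @LieBracket F (g * V)%type cext_fun cext_skew cext_jacobi.
End Bracket.

(* The subspace {0} x V of g x V. *)
Definition ext_kernel : {vspace g * V} :=
  lker (linfun (fst : (g * V)%type -> g)).

Lemma mem_ext_kernel s : (s \in ext_kernel) = (s.1 == 0).
Proof. by rewrite memv_ker lfunE. Qed.

Section Form.
Variable B : {symmetric (g * V)%type}.

Definition kernel_form (u v : V) : F := B (0, u) (0, v).

Fact kernel_form_bilinear : bilinear_for
  (GRing.Scale.Law.clone _ _ *%R _) (GRing.Scale.Law.clone _ _ *%R _)
  kernel_form.
Proof.
have E c (u v : V) : (0, c *: u + v) = c *: (0, u) + (0, v) :> g * V.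
  by congr pair; rewrite /= scaler0 addr0.
by split=> w c u v; rewrite /kernel_form /= E ?linearPl ?linearPr.
Qed.
HB.instance Definition _ :=
  bilinear_isBilinear.Build F V V F _ _ kernel_form kernel_form_bilinear.
Fact kernel_form_sym u v :
  kernel_form u v = (-1) ^+ false * idfun (kernel_form v u).
Proof. exact: hermC. Qed.
HB.instance Definition _ :=
  isHermitianSesquilinear.Build F V false idfun kernel_form kernel_form_sym.
End Form.

End CentralExtension.

Definition dual (F : fieldType) (a : vectType F) : vectType F := 'Hom(a, F^o).

Definition dce_chi (F : fieldType) (h a : vectType F) (Bh : {symmetric h})
    (Psi : {bilinear a -> a -> h}) (s : a) (x : h) : dual a :=
  linfun (fun t : a => - Bh (Psi s t) x : F^o).

Definition dce_Phi (F : fieldType) (h a : vectType F) (Bh : {symmetric h})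
    (phi : 'Hom(a, 'End(h))) (x y : h) : dual a :=
  linfun (fun t : a => Bh (phi t x) y : F^o).

Record dce_data (F : fieldType) (h a : vectType F) (brh : lie_bracket h)
    (Bh : {symmetric h}) := DceData {
  phi : 'Hom(a, 'End(h));
  Psi : {bilinear a -> a -> h};
  omega : {bilinear a -> a -> dual a};
  phi_derivation : forall s x y,
    phi s (brh x y) = brh (phi s x) y + brh x (phi s y);
  phi_skew : forall s x y, Bh (phi s x) y = - Bh x (phi s y);
  Psi_skew : forall s t, Psi s t = - Psi t s;
  omega_skew : forall s t, omega s t = - omega t s;
  phi_commutator : forall s t x,
    phi s (phi t x) - phi t (phi s x) = brh (Psi s t) x;
  phi_Psi_cyclic : forall s t u,
    phi s (Psi t u) + phi t (Psi u s) + phi u (Psi s t) = 0;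
  chi_Psi_cyclic : forall s t u,
    dce_chi Bh Psi s (Psi t u) + dce_chi Bh Psi t (Psi u s)
      + dce_chi Bh Psi u (Psi s t) = 0;
  omega_cyclic : forall s t u, omega s t u = omega t u s }.

Section DoubleCentralExtension.
Variables (F : fieldType) (h a : vectType F).
Variables (brh : lie_bracket h) (Bh : {symmetric h}).

Section Data.
Variable D : dce_data a brh Bh.
Local Notation phi := (phi D).
Local Notation Psi := (Psi D).
Local Notation omega := (omega D).
Local Notation chi := (dce_chi Bh Psi).
Local Notation Phi := (dce_Phi Bh phi).
Local Notation E := (a * h * dual a)%type.

Lemma dce_chiE s x t : chi s x t = - Bh (Psi s t) x.
Proof.
have lin : linear (fun t : a => - Bh (Psi s t) x : F^o).
  by move=> c u v; rewrite linearPr linearPl /= opprD scalerN.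
pose flin := GRing.isLinear.Build _ _ _ _ _ lin.
pose f : {linear a -> F^o} := HB.pack (fun t : a => - Bh (Psi s t) x : F^o) flin.
exact: (lfunE f).
Qed.

Lemma dce_PhiE x y t : Phi x y t = Bh (phi t x) y.
Proof.
have lin : linear (fun t : a => Bh (phi t x) y : F^o).
  by move=> c u v; rewrite linearP add_lfunE scale_lfunE linearPl.
pose flin := GRing.isLinear.Build _ _ _ _ _ lin.
pose f : {linear a -> F^o} := HB.pack (fun t : a => Bh (phi t x) y : F^o) flin.
exact: (lfunE f).
Qed.

(* The bracket of s = a + x + alpha and t = b + y + beta, the values on
   h x a being those prescribed by skew-symmetry. *)
Definition dce_fun (s t : E) : E :=
  (0,
   Psi s.1.1 t.1.1 + phi s.1.1 t.1.2 - phi t.1.1 s.1.2 + brh s.1.2 t.1.2,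
   omega s.1.1 t.1.1 + chi s.1.1 t.1.2 - chi t.1.1 s.1.2
     + Phi s.1.2 t.1.2).


Lemma dce_chiPl c s t x : chi (c *: s + t) x = c *: chi s x + chi t x.
Proof.
apply/lfunP => u; rewrite add_lfunE scale_lfunE !dce_chiE /GRing.scale /=.
by rewrite linearPl linearPl /=; ring.
Qed.

Lemma dce_chiPr c s x y : chi s (c *: x + y) = c *: chi s x + chi s y.
Proof.
apply/lfunP => u; rewrite add_lfunE scale_lfunE !dce_chiE /GRing.scale /=.
by rewrite linearPr /=; ring.
Qed.

Lemma dce_PhiPl c x y z : Phi (c *: x + y) z = c *: Phi x z + Phi y z.
Proof.
apply/lfunP => u; rewrite add_lfunE scale_lfunE !dce_PhiE /GRing.scale /=.
by rewrite linearP linearPl.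
Qed.

Lemma dce_PhiPr c x y z : Phi z (c *: x + y) = c *: Phi z x + Phi z y.
Proof.
apply/lfunP => u; rewrite add_lfunE scale_lfunE !dce_PhiE /GRing.scale /=.
by rewrite linearPr.
Qed.

Lemma dce_phiPl c s t x : phi (c *: s + t) x = c *: phi s x + phi t x.
Proof. by rewrite linearP add_lfunE scale_lfunE. Qed.

Let regroup (W : lmodType F) c (p p' q q' r r' s s' : W) :
  c *: p + p' + (c *: q + q') - (c *: r + r') + (c *: s + s')
    = c *: (p + q - r + s) + (p' + q' - r' + s').
Proof.
rewrite opprD (addrACA (c *: p)) (addrACA (c *: p + c *: q)).
by rewrite (addrACA (_ - _)) !scalerDr scalerN.
Qed.

Fact dce_fun_bilinear : bilinear_for
  (GRing.Scale.Law.clone _ _ *:%R _) (GRing.Scale.Law.clone _ _ *:%R _)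
  dce_fun.
Proof.
split=> u c s t; rewrite /dce_fun /=; congr (_, _, _) => /=.
- by rewrite scaler0 addr0.
- by rewrite linearPl dce_phiPl linearP linearPl /= regroup.
- by rewrite linearPl dce_chiPl dce_chiPr dce_PhiPl /= regroup.
- by rewrite scaler0 addr0.
- by rewrite linearPr linearP dce_phiPl linearPr /= regroup.
- by rewrite linearPr dce_chiPr dce_chiPl dce_PhiPr /= regroup.
Qed.
HB.instance Definition _ :=
  bilinear_isBilinear.Build F E E E _ _ dce_fun dce_fun_bilinear.

Lemma dce_Phi_skew x y : Phi x y = - Phi y x.
Proof.
apply/lfunP => u; rewrite opp_lfunE !dce_PhiE phi_skew hermC /=.
by rewrite expr0 mul1r.
Qed.

Fact dce_skew s t : dce_fun s t = - dce_fun t s.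
Proof.
rewrite /dce_fun; congr (_, _, _) => /=; first by rewrite oppr0.
  by rewrite Psi_skew [brh _ _]lie_skew !opprD opprK [- _ - _ + _]addrAC.
by rewrite omega_skew dce_Phi_skew !opprD opprK [- _ - _ + _]addrAC.
Qed.

Let form_inj x y : nondegenerate Bh -> (forall z, Bh x z = Bh y z) -> x = y.
Proof.
move=> /eqP Bnd e; apply/eqP; rewrite -subr_eq0 -memv0 -Bnd.
by apply/mem_orthovP => z _; rewrite linearBl /= e subrr.
Qed.

Hypothesis Bh_metric : invariant_metric brh Bh.

Fact dce_jacobi s t u :
  dce_fun s (dce_fun t u) + dce_fun t (dce_fun u s)
    + dce_fun u (dce_fun s t) = 0.
Proof.
have [Bnd Binv] := Bh_metric.
have BC x y : Bh x y = Bh y x by rewrite hermC /= expr0 mul1r.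
have BD p q r : Bh (p + q) r = Bh p r + Bh q r by rewrite linearDl.
have BN p r : Bh (- p) r = - Bh p r by rewrite linearNl.
have BDr p q r : Bh r (p + q) = Bh r p + Bh r q by rewrite linearDr.
have BNr p r : Bh r (- p) = - Bh r p by rewrite linearNr.
have brD p q r : brh r (p + q) = brh r p + brh r q by rewrite linearDr.
have brN p r : brh r (- p) = - brh r p by rewrite linearNr.
have phiD v p q : phi v (p + q) = phi v p + phi v q by rewrite linearD.
have phiN v p : phi v (- p) = - phi v p by rewrite linearN.
case: s t u => [[s x] f] [[t y] k] [[u z] l].
rewrite /dce_fun /=; congr (_, _, _) => /=; first by rewrite !addr0.
  apply: form_inj => // w.
  have Jac := congr1 (Bh^~ w) (lie_jacobi brh x y z).
  have Cyc := congr1 (Bh^~ w) (phi_Psi_cyclic D s t u).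
  have C1 := congr1 (Bh^~ w) (phi_commutator D s t z).
  have C2 := congr1 (Bh^~ w) (phi_commutator D t u x).
  have C3 := congr1 (Bh^~ w) (phi_commutator D u s y).
  move: Jac Cyc C1 C2 C3.
  rewrite /= !linear0r !linear0 !zero_lfunE.
  rewrite !(phiD, phiN, brD, brN) !phi_derivation.
  rewrite [brh (phi s y) z]lie_skew [brh (phi t z) x]lie_skew.
  rewrite [brh (phi u x) y]lie_skew [brh (Psi s t) z]lie_skew.
  rewrite [brh (Psi t u) x]lie_skew [brh (Psi u s) y]lie_skew.
  rewrite !(BD, BN) linear0l /=.
  move=> /(canRL (addKr _)) -> /(canRL (addKr _)) -> /(canRL (subrK _)) ->.
  by move=> /(canRL (subrK _)) -> /(canRL (subrK _)) ->; ring.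
apply/lfunP => w.
have PsiC p q r : Bh (Psi p q) r = - Bh (Psi q p) r.
  by rewrite Psi_skew linearNl.
have Z p q v : - Bh (Psi p w) (phi q v) + Bh (Psi q w) (phi p v)
    + Bh (phi w v) (Psi p q) = 0.
  have E0 := congr1 (Bh^~ v) (phi_Psi_cyclic D q p w).
  rewrite /= !BD linear0l /= !phi_skew in E0.
  by rewrite (PsiC q w) [Bh (phi w v) _]BC (PsiC p q) -[RHS]E0; ring.
have W p v v' : - Bh (Psi p w) (brh v v') + Bh (phi w v') (phi p v)
    - Bh (phi w v) (phi p v') = 0.
  have E0 := congr1 (Bh^~ v') (phi_commutator D w p v).
  rewrite /= BD BN -Binv PsiC in E0.
  rewrite [Bh (phi w (phi p v)) _]phi_skew in E0.
  rewrite [Bh (phi p (phi w v)) _]phi_skew in E0.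
  by rewrite -E0 [Bh (phi w v') _]BC; ring.
have X : Bh (phi w x) (brh y z) + Bh (phi w y) (brh z x)
    + Bh (phi w z) (brh x y) = 0.
  rewrite (phi_skew D w z) phi_derivation BDr Binv.
  by rewrite [Bh _ (brh z x)]BC -(Binv z x) [Bh z (brh _ y)]BC; ring.
have omega0 p : omega p 0 = 0 by rewrite linear0r.
have chi0 r : chi 0 r = 0.
  by apply/lfunP => v; rewrite dce_chiE linear0l /= linear0l oppr0 zero_lfunE.
rewrite !omega0 !chi0.
have := congr1 (fun f : dual a => f w) (chi_Psi_cyclic D s t u).
rewrite !(add_lfunE, opp_lfunE, zero_lfunE) !dce_chiE !dce_PhiE.
rewrite !(BDr, BNr) => Cyc.
have red (p q : F) : q = 0 -> p - q = 0 -> p = 0 by move=> ->; rewrite subr0.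
apply: (red _ _ Cyc); apply: (red _ _ X).
apply: (red _ _ (Z s t z)); apply: (red _ _ (Z t u x)).
apply: (red _ _ (Z u s y)); apply: (red _ _ (W s y z)).
apply: (red _ _ (W t z x)); apply: (red _ _ (W u x y)).
by ring.
Qed.

Definition double_central_extension : lie_bracket E :=
  @LieBracket F E dce_fun dce_skew dce_jacobi.

End Data.

Definition dce_form (s t : a * h * dual a) : F :=
  Bh s.1.2 t.1.2 + t.2 s.1.1 + s.2 t.1.1.

Fact dce_form_bilinear : bilinear_for
  (GRing.Scale.Law.clone _ _ *%R _) (GRing.Scale.Law.clone _ _ *%R _)
  dce_form.
Proof.
have Z c (v : F^o) : c *: v = c * v by [].
split=> u c s t; rewrite /dce_form /=.
  by rewrite linearPl linearP add_lfunE scale_lfunE /= !Z; ring.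
by rewrite linearPr linearP add_lfunE scale_lfunE /= !Z; ring.
Qed.
HB.instance Definition _ := bilinear_isBilinear.Build F
  (a * h * dual a)%type (a * h * dual a)%type F _ _ dce_form dce_form_bilinear.
Fact dce_form_sym s t : dce_form s t = (-1) ^+ false * idfun (dce_form t s).
Proof. by rewrite /dce_form hermC /=; ring. Qed.
HB.instance Definition _ := isHermitianSesquilinear.Build F
  (a * h * dual a)%type false idfun dce_form dce_form_sym.

Lemma dce_form_nondegenerate : nondegenerate Bh ->
  nondegenerate (dce_form : {symmetric (a * h * dual a)%type}).
Proof.
move=> /eqP Bnd; apply/eqP/vspaceP => s; rewrite memv0.
apply/mem_orthovP/eqP => [s0 | -> v _]; last by rewrite linear0l.
have h0 : s.1.2 = 0.
  apply/eqP; rewrite -memv0 -Bnd; apply/mem_orthovP => y _.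
  have := s0 (0, y, 0) (memvf _).
  by rewrite /= /dce_form /= linear0 zero_lfunE !addr0.
have d0 : s.2 = 0.
  apply/lfunP => t; have := s0 (t, 0, 0) (memvf _).
  by rewrite /= /dce_form /= linear0r !zero_lfunE addr0 add0r.
have a0 : s.1.1 = 0.
  rewrite (coord_vbasis (memvf s.1.1)) big1 // => i _.
  have := s0 (0, 0, linfun (coord (vbasis {:a}) i : a -> F^o)) (memvf _).
  rewrite /= /dce_form /= linear0r linear0 add0r addr0 lfunE /= => ->.
  by rewrite scale0r.
by case: s h0 d0 a0 {s0} => [[? ?] ?] /= -> -> ->.
Qed.

Lemma dce_metric (D : dce_data a brh Bh) (Bh_metric : invariant_metric brh Bh) :
  invariant_metric (double_central_extension D Bh_metric) dce_form.
Proof.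
have [Bnd Binv] := Bh_metric; split; first exact: dce_form_nondegenerate.
have BC x y : Bh x y = Bh y x by rewrite hermC /= expr0 mul1r.
move=> [[s x] f] [[t y] k] [[u z] l].
rewrite /= /dce_form /= /dce_fun /= !linear0 addr0.
rewrite !(add_lfunE, opp_lfunE) !dce_chiE !dce_PhiE.
rewrite !(linearDr, linearNr, linearDl, linearNl) /= Binv -omega_cyclic.
rewrite (phi_skew D t x) (phi_skew D u x) [Bh x (Psi D t u)]BC.
by rewrite [Psi D u s]Psi_skew [Psi D t s]Psi_skew !linearNl /=; ring.
Qed.

End DoubleCentralExtension.

(* Main.v *)
(* For a nondegenerate kernel V, invariance gives [G, G] <= V^perp, so that
   G = V^perp + V is an orthogonal sum of ideals and V^perp projects
   isomorphically onto g.  For an isotropic V, the adjoint of V -> G with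
   respect to the metrics of g and G embeds V into the center of g, the
   orthogonal of [g, g].  A Witt decomposition G = a + h + V, with a isotropic
   and dual to V and h orthogonal to a + V, transports the bracket of G to
   a * h * dual a; there invariance and the centrality of dual a express every
   component of the bracket through the bracket of h, phi, Psi and omega, and
   the Jacobi identity yields their compatibility conditions.  Finally
   [G, G] <= V^perp = h + V projects into the image of h in g. *)
From HB Require Import structures.
Require Import Defs.
From mathcomp Require Import all_boot all_order all_algebra.
From mathcomp Require Import ring.

Set Implicit Arguments.
Unset Strict Implicit.
Unset Printing Implicit Defensive.

Import GRing.Theory.
Local Open Scope ring_scope.

(** * Bilinear maps, symmetric forms and duality *)

Section BilinearMaps.
Variable F : fieldType.

Section Comp.
Variables (U1 U2 W1 W2 W W' : vectType F) (b : {bilinear W1 -> W2 -> W}).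
Variables (p : {linear W -> W'}).
Variables (f1 : {linear U1 -> W1}) (f2 : {linear U2 -> W2}).

(** With [p] inverse to [f1 = f2] this is a transported bracket; with injections and a projection of
    a direct sum it is one component of a bracket. *)
Definition bilinear_comp x y : W' := p (b (f1 x) (f2 y)).

Fact bilinear_comp_bilinear : bilinear_for
  (GRing.Scale.Law.clone _ _ *:%R _) (GRing.Scale.Law.clone _ _ *:%R _)
  bilinear_comp.
Proof.
by split=> u c x y; rewrite /bilinear_comp linearP ?linearPl ?linearPr linearP.
Qed.
HB.instance Definition _ := bilinear_isBilinear.Build F
  U1 U2 W' _ _ bilinear_comp bilinear_comp_bilinear.
End Comp.

Section Pullback.
Variables (U W : vectType F) (B : {symmetric W}) (f : {linear U -> W}).

Definition form_pullback x y : F := B (f x) (f y).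

Fact form_pullback_bilinear : bilinear_for
  (GRing.Scale.Law.clone _ _ *%R _) (GRing.Scale.Law.clone _ _ *%R _)
  form_pullback.
Proof.
by split=> u c x y; rewrite /form_pullback linearP ?linearPl ?linearPr.
Qed.
HB.instance Definition _ := bilinear_isBilinear.Build F
  U U F _ _ form_pullback form_pullback_bilinear.
Fact form_pullback_sym x y :
  form_pullback x y = (-1) ^+ false * idfun (form_pullback y x).
Proof. exact: hermC. Qed.
HB.instance Definition _ :=
  isHermitianSesquilinear.Build F U false idfun form_pullback form_pullback_sym.
End Pullback.

Section Curry.
Variables (U V W : vectType F) (b : {bilinear U -> V -> W}).

Definition bilinear_curry : 'Hom(U, 'Hom(V, W)) :=
  linfun (fun x => linfun (b x)).

Lemma bilinear_curryE x y : bilinear_curry x y = b x y.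
Proof.
have lin : linear (fun x => linfun (b x)).
  move=> c u v; apply/lfunP => w.
  by rewrite add_lfunE scale_lfunE !lfunE /= linearPl.
pose flin := GRing.isLinear.Build _ _ _ _ _ lin.
pose f : {linear U -> 'Hom(V, W)} := HB.pack (fun x => linfun (b x)) flin.
by rewrite /bilinear_curry (lfunE f) lfunE.
Qed.
End Curry.

Section Forms.
Variables (L : vectType F) (B : {symmetric L}).

Lemma sym_formC x y : B x y = B y x.
Proof. by rewrite hermC /= expr0 mul1r. Qed.

Lemma nondegenerateP :
  reflect (forall x, (forall y, B x y = 0) -> x = 0) (nondegenerate B).
Proof.
apply: (iffP idP) => [/eqP Bnd x Bx0 | Bnd].
  by apply/eqP; rewrite -memv0 -Bnd; apply/mem_orthovP.
apply/eqP/vspaceP => x; rewrite memv0; apply/mem_orthovP/eqP => [Bx0 | -> y _].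
  by apply: Bnd => y; rewrite Bx0 ?memvf.
by rewrite linear0l.
Qed.

Definition form_dual : 'Hom(L, dual L) :=
  linfun (fun x => linfun (fun y => B x y : F^o) : dual L).

Lemma form_dualE x y : form_dual x y = B x y.
Proof.
have lin1 z : linear (fun y => B z y : F^o).
  by move=> c u v; rewrite linearPr.
pose B1 z : {linear L -> F^o} :=
  HB.pack (fun y => B z y : F^o) (GRing.isLinear.Build _ _ _ _ _ (lin1 z)).
have lin : linear (fun x => linfun (fun y => B x y : F^o) : dual L).
  move=> c u v; apply/lfunP => w.
  by rewrite add_lfunE scale_lfunE (lfunE (B1 _)) !(lfunE (B1 _)) /= linearPl.
pose f : {linear L -> dual L} :=
  HB.pack (fun x => linfun (fun y => B x y : F^o) : dual L)
    (GRing.isLinear.Build _ _ _ _ _ lin).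
by rewrite /form_dual (lfunE f) (lfunE (B1 x)).
Qed.

Lemma dim_dual : dim (dual L) = dim L.
Proof. exact: muln1. Qed.

(** Nondegeneracy makes [form_dual] injective, and [dual L] has the dimension of [L]. *)
Lemma limg_form_dual : nondegenerate B -> limg form_dual = fullv.
Proof.
move=> /nondegenerateP Bnd.
have k0 : lker form_dual == 0%VS.
  apply/lker0P => x y /lfunP e; apply/eqP; rewrite -subr_eq0; apply/eqP/Bnd => z.
  by move: (e z); rewrite !form_dualE linearBl /= => ->; rewrite subrr.
apply/eqP; rewrite eqEdim subvf /= limg_dim_eq ?(eqP k0) ?capv0 //.
by rewrite !dimvf dim_dual.
Qed.

Lemma nondegenerate_repr (l : dual L) :
  nondegenerate B -> exists x, forall y, B x y = l y.
Proof.
move=> /limg_form_dual Bfull.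
have /memv_imgP[x _ ->] : l \in limg form_dual by rewrite Bfull memvf.
by exists x => y; rewrite form_dualE.
Qed.

End Forms.

(** The value [k' s] is the vector representing the functional [B' s (k _)], obtained through the
    inverse of [form_dual B]; this makes it linear in [s]. *)
Lemma form_adjoint (L M : vectType F) (B : {symmetric L}) (B' : {symmetric M})
    (k : {linear L -> M}) : nondegenerate B ->
  exists k' : 'Hom(M, L), forall s x, B (k' s) x = B' s (k x).
Proof.
move=> /limg_form_dual Bfull.
pose k0 s := ((form_dual B)^-1)%VF (form_dual B' s \o linfun k)%VF.
have lin : linear k0.
  by move=> c s t; rewrite /k0 linearP comp_lfunDl -comp_lfunZl linearP.
exists (linfun (HB.pack k0 (GRing.isLinear.Build _ _ _ _ _ lin) : {linear _ -> _})).
move=> s x; rewrite lfunE /= /k0 -form_dualE limg_lfunVK ?Bfull ?memvf //.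
by rewrite comp_lfunE lfunE form_dualE.
Qed.

Lemma dim_bijective (U W : vectType F) (f : {linear U -> W}) :
  bijective f -> dim U = dim W.
Proof.
move=> [g fK gK]; rewrite -!dimvf.
rewrite -(limg_dim_eq (U := fullv) (f := linfun f)).
  congr (\dim _); apply/eqP; rewrite eqEsubv subvf; apply/subvP => x _.
  by apply/memv_imgP; exists (g x); rewrite ?memvf // lfunE /= gK.
apply/eqP; rewrite -subv0; apply/subvP => x.
rewrite memv_cap memv_ker lfunE memv0 => /andP[_ /eqP fx0].
by rewrite -(fK x) -(fK 0) fx0 linear0.
Qed.

Lemma dual_separates (L : vectType F) (x : L) :
  (forall l : dual L, l x = 0) -> x = 0.
Proof.
move=> l0; rewrite (coord_vbasis (memvf x)) big1 // => i _.
have := l0 (linfun (coord (vbasis {:L}) i : L -> F^o)).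
by rewrite lfunE /= => ->; rewrite scale0r.
Qed.

End BilinearMaps.

(** * Transport of a quadratic Lie structure along a linear bijection *)

Section Transport.
Variables (F : fieldType) (L1 L2 : vectType F) (br2 : lie_bracket L2).

Section Bracket.
Variables (f : {linear L1 -> L2}) (f' : {linear L2 -> L1}) (f'K : cancel f' f).

Fact transport_skew x y :
  bilinear_comp br2 f' f f x y = - bilinear_comp br2 f' f f y x.
Proof. by rewrite /bilinear_comp lie_skew linearN. Qed.

Fact transport_jacobi (b := bilinear_comp br2 f' f f) x y z :
  b x (b y z) + b y (b z x) + b z (b x y) = 0.
Proof. by rewrite /b /bilinear_comp !f'K -!linearD lie_jacobi linear0. Qed.

Definition transport_bracket : lie_bracket L1 :=
  LieBracket transport_skew transport_jacobi.

End Bracket.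

Lemma lie_isometry_transport (B1 : {symmetric L1}) (B2 : {symmetric L2})
    (f : {linear L1 -> L2}) :
  invariant_metric br2 B2 -> bijective f -> isometry B2 B1 f ->
  exists br1 : lie_bracket L1,
    invariant_metric br1 B1 /\ lie_isometry br1 B1 br2 B2 f.
Proof.
move=> [/nondegenerateP B2nd B2inv] [g fK gK] iso.
pose f' : {linear L2 -> L1} :=
  HB.pack g (GRing.isLinear.Build _ _ _ _ _ (can2_linear fK gK)).
exists (@transport_bracket f f' gK); split; last first.
  split=> //; [exact: linearP | by exists g | ].
  by move=> x y; rewrite /= /bilinear_comp /= gK.
split=> [|x y z].
  apply/nondegenerateP => x x0; apply: (can_inj fK); rewrite linear0.
  by apply: B2nd => y; rewrite -(gK y) iso.
by rewrite /= -!iso /bilinear_comp /= !gK.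
Qed.

End Transport.

(** * Recovering the data of a double central extension from its bracket and metric *)

Section ReadOff.
Variables (F : fieldType) (h a : vectType F) (Bh : {symmetric h}).
Local Notation E := (a * h * dual a)%type.
Variable br : lie_bracket E.
Hypothesis br_metric : invariant_metric br (dce_form Bh : {symmetric E}).
Hypothesis br_central : forall (al : dual a) s, br (0, 0, al) s = 0.

Let in_a (s : a) : E := (s, 0, 0).
Let in_h (x : h) : E := (0, x, 0).

Let in_a_linear : linear in_a.
Proof. by move=> c x y; congr (_, _, _); rewrite /= scaler0 addr0. Qed.
Let in_h_linear : linear in_h.
Proof. by move=> c x y; congr (_, _, _); rewrite /= scaler0 addr0. Qed.

Let ia : {linear a -> E} :=
  HB.pack in_a (GRing.isLinear.Build _ _ _ _ _ in_a_linear).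
Let ih : {linear h -> E} :=
  HB.pack in_h (GRing.isLinear.Build _ _ _ _ _ in_h_linear).
Let ph : {linear E -> h} := (snd \o fst : E -> h).
Let pd : {linear E -> dual a} := (snd : E -> dual a).

Let Bnd : forall x : E, (forall y : E, dce_form Bh x y = 0) -> x = 0.
Proof. by case: br_metric => /nondegenerateP. Qed.
Let Binv (x y z : E) : dce_form Bh x (br y z) = dce_form Bh (br x y) z.
Proof. by case: br_metric => _ ->. Qed.

(** By invariance, [l] takes on the [a]-component of a bracket the value of the form at
    [br (0, 0, l) s] and [t], which vanishes by centrality. *)
Let br_fst (s t : E) : (br s t).1.1 = 0.
Proof.
apply: dual_separates => l; have := Binv (0, 0, l) s t.
by rewrite br_central linear0l /dce_form /= linear0l linear0 !add0r.
Qed.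

Let br_dual (s t : E) : br s t = br s (t.1.1, t.1.2, 0).
Proof.
have {1}-> : t = (t.1.1, t.1.2, 0) + (0, 0, t.2).
  by case: t => [[u y] k]; congr (_, _, _); rewrite /= ?addr0 ?add0r.
by rewrite linearDr /= [br s (0, 0, _)]lie_skew br_central oppr0 addr0.
Qed.

(** A bracket has no [a]-component and its dual component is central, so only its [h]-component
    acts. This turns the Jacobi identity into [jac], whose [h]- and dual components are the
    compatibility conditions. *)
Let br_br s t u : br s (br t u) = br s (ih (br t u).1.2).
Proof. by rewrite br_dual br_fst. Qed.

Let jac s t u : br s (ih (br t u).1.2) + br t (ih (br u s).1.2)
  + br u (ih (br s t).1.2) = 0.
Proof. by rewrite -!br_br lie_jacobi. Qed.

Let inv (s t u : E) : Bh s.1.2 (br t u).1.2 + (br t u).2 s.1.1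
  = Bh (br s t).1.2 u.1.2 + (br s t).2 u.1.1.
Proof.
by have := Binv s t u; rewrite /dce_form !br_fst !linear0 !addr0.
Qed.

Let brh_bil : {bilinear h -> h -> h} := bilinear_comp br ph ih ih.

Let brh_skew x y : brh_bil x y = - brh_bil y x.
Proof. by rewrite /= /bilinear_comp lie_skew linearN. Qed.

Let brh_jacobi x y z :
  brh_bil x (brh_bil y z) + brh_bil y (brh_bil z x) + brh_bil z (brh_bil x y) = 0.
Proof. exact: (congr1 ph (jac (ih x) (ih y) (ih z))). Qed.

Let brh : lie_bracket h := LieBracket brh_skew brh_jacobi.

Let brh_metric : invariant_metric brh Bh.
Proof.
split=> [|x y z].
  apply/nondegenerateP => x x0; suff: ih x = 0 by move=> /(congr1 ph).
  apply: Bnd => -[[s y] l].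
  by rewrite /dce_form /= x0 linear0 zero_lfunE !addr0.
by have := inv (ih x) (ih y) (ih z); rewrite /= !linear0 !addr0.
Qed.

Let phi0 : 'Hom(a, 'End(h)) := bilinear_curry (bilinear_comp br ph ia ih).
Let phi0E s x : phi0 s x = (br (ia s) (ih x)).1.2.
Proof. exact: bilinear_curryE. Qed.
Let Psi0 : {bilinear a -> a -> h} := bilinear_comp br ph ia ia.
Let omega0 : {bilinear a -> a -> dual a} := bilinear_comp br pd ia ia.

Let P_skew s t : (br s t).1.2 = - (br t s).1.2.
Proof. by rewrite lie_skew. Qed.
Let Q_skew s t : (br s t).2 = - (br t s).2.
Proof. by rewrite lie_skew. Qed.

(** The pairing with [ia s] extracts a dual component, so invariance forces it to be the one
    prescribed by [dce_Phi]; likewise [chiE] for [dce_chi]. *)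
Let PhiE x y s : (br (ih x) (ih y)).2 s = Bh (phi0 s x) y.
Proof.
have := inv (ia s) (ih x) (ih y).
by rewrite /= linear0l linear0 add0r addr0 phi0E.
Qed.

Let chiE s x t : (br (ia s) (ih x)).2 t = - Bh (Psi0 s t) x.
Proof.
have := inv (ia t) (ia s) (ih x).
rewrite /= linear0l linear0 add0r addr0 => ->.
by rewrite P_skew linearNl.
Qed.

Let jacP s t u : (br s (ih (br t u).1.2)).1.2 + (br t (ih (br u s).1.2)).1.2
  + (br u (ih (br s t).1.2)).1.2 = 0.
Proof. exact: (congr1 ph (jac s t u)). Qed.

Let phiN x s : (br (ih x) (ia s)).1.2 = - phi0 s x.
Proof. by rewrite P_skew phi0E. Qed.

Let PN s x : (br s (ih (- x))).1.2 = - (br s (ih x)).1.2.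
Proof. by rewrite linearN linearNr. Qed.

Let phi0_skew s x y : Bh (phi0 s x) y = - Bh x (phi0 s y).
Proof.
have := inv (ih x) (ih y) (ia s).
by rewrite /= linear0r linear0 add0r addr0 PhiE phiN linearNr.
Qed.

(** This is the [h]-component of the Jacobi identity on one vector of [a] and two of [h]; two
    vectors of [a] and one of [h] give [phi0_commutator], and three vectors of [a] give the cyclic
    identities. *)
Let phi0_derivation s x y :
  phi0 s (brh x y) = brh (phi0 s x) y + brh x (phi0 s y).
Proof.
have := jacP (ia s) (ih x) (ih y).
rewrite phiN PN -!phi0E [brh (phi0 s x) y]lie_skew => /eqP.
by rewrite -addrA addr_eq0 opprD opprK addrC => /eqP.
Qed.

Let phi0_commutator s t x :
  phi0 s (phi0 t x) - phi0 t (phi0 s x) = brh (Psi0 s t) x.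
Proof.
have := jacP (ia s) (ia t) (ih x).
rewrite phiN PN -!phi0E => /eqP.
by rewrite addr_eq0 [brh _ x]lie_skew => /eqP.
Qed.

Let phi0_Psi0_cyclic s t u :
  phi0 s (Psi0 t u) + phi0 t (Psi0 u s) + phi0 u (Psi0 s t) = 0.
Proof. by rewrite !phi0E; apply: jacP. Qed.

Let chi_dce s x : dce_chi Bh Psi0 s x = (br (ia s) (ih x)).2.
Proof.
apply/lfunP => t; rewrite chiE.
have lin : linear (fun t : a => - Bh (Psi0 s t) x : F^o).
  by move=> c u v; rewrite linearPr linearPl /= opprD scalerN.
pose f : {linear a -> F^o} :=
  HB.pack (fun t : a => - Bh (Psi0 s t) x : F^o)
    (GRing.isLinear.Build _ _ _ _ _ lin).
exact: (lfunE f).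
Qed.

Let chi_Psi0_cyclic (chi := dce_chi Bh Psi0) s t u :
  chi s (Psi0 t u) + chi t (Psi0 u s) + chi u (Psi0 s t) = 0.
Proof. by rewrite /chi !chi_dce; apply: (congr1 pd (jac _ _ _)). Qed.

Let omega0_cyclic s t u : omega0 s t u = omega0 t u s.
Proof.
have := inv (ia s) (ia t) (ia u).
by rewrite /= linear0l linear0r !add0r.
Qed.

Lemma dce_of_metric : exists (brh : lie_bracket h)
    (Bh_metric : invariant_metric brh Bh) (D : dce_data a brh Bh),
  forall s t, double_central_extension D Bh_metric s t = br s t.
Proof.
exists brh, brh_metric.
pose D := @DceData F h a brh Bh phi0 Psi0 omega0 phi0_derivation
  phi0_skew (fun s t => P_skew (ia s) (ia t)) (fun s t => Q_skew (ia s) (ia t)) phi0_commutator phi0_Psi0_cyclic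
  chi_Psi0_cyclic omega0_cyclic; exists D.
move=> [[s x] l] [[t y] k].
(* Centrality discards the dual components of both arguments; what remains is expanded bilinearly
   over [ia] and [ih]. *)
rewrite br_dual [br (s, x, l) _]lie_skew br_dual -lie_skew /=.
have split_E u z : (u, z, 0) = ia u + ih z :> E.
  by congr (_, _, _); rewrite /= ?addr0 ?add0r.
have -> u v : br u v = (0, (br u v).1.2, (br u v).2).
  by rewrite -(br_fst u v) -!surjective_pairing.
rewrite !split_E linearDl !linearDr /= /dce_fun /=; congr (_, _, _).
  by rewrite !phi0E [(br (ih x) (ia t)).1.2]P_skew !addrA.
rewrite !chi_dce [(br (ih x) (ia t)).2]Q_skew !addrA; congr (_ + _).
by apply/lfunP => u; rewrite PhiE (dce_PhiE D).
Qed.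
End ReadOff.

(** The bracket of [L] is pulled back along [f], and [dce_of_metric] identifies the result as a
    double central extension. *)
Lemma dce_of_isometry (F : fieldType) (h a L : vectType F)
    (Bh : {symmetric h}) (br : lie_bracket L) (B : {symmetric L})
    (f : {linear (a * h * dual a)%type -> L}) :
  invariant_metric br B -> bijective f -> isometry B (dce_form Bh) f ->
  (forall l s, br (f (0, 0, l)) s = 0) ->
  exists (brh : lie_bracket h) (Bh_metric : invariant_metric brh Bh)
      (D : dce_data a brh Bh),
    lie_isometry (double_central_extension D Bh_metric) (dce_form Bh) br B f.
Proof.
move=> B_metric f_bij f_iso f_central.
have [brE [brE_metric [f_lin _ f_br _]]] :=
  lie_isometry_transport B_metric f_bij f_iso.
have brE_central l s : brE (0, 0, l) s = 0.
  by apply: (bij_inj f_bij); rewrite f_br f_central linear0.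
have [brh [Bh_metric [D DE]]] := dce_of_metric brE_metric brE_central.
by exists brh, Bh_metric, D; split=> // s t; rewrite DE f_br.
Qed.

(** * Witt decomposition along an isotropic subspace *)

Section SplittingMap.
Variables (F : fieldType) (L V : vectType F) (j : {linear V -> L}).
Variables (a h : {vspace L}) (iota : 'Hom(dual (subvs_of a), V)).

Definition splitting_map (t : subvs_of a * subvs_of h * dual (subvs_of a)) : L :=
  vsval t.1.1 + vsval t.1.2 + j (iota t.2).

Fact splitting_map_linear : linear splitting_map.
Proof.
move=> k s t; rewrite /splitting_map !linearP !scalerDr /=.
by rewrite (addrACA (k *: _)) (addrACA (k *: _ + k *: _)).
Qed.
HB.instance Definition _ :=
  GRing.isLinear.Build _ _ _ _ splitting_map splitting_map_linear.
End SplittingMap.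
Arguments splitting_map {F L V} j {a} h iota t.

Section IsotropicComplement.
Variables (F : fieldType) (L V : vectType F) (B : {symmetric L}).
Variables (j : {linear V -> L}) (p : {linear L -> V}).
Hypotheses (two_neq0 : 2 != 0 :> F) (jK : cancel j p).
Hypotheses (B_nondeg : nondegenerate B) (j_iso : forall u v, B (j u) (j v) = 0).

(** The subspace [a] is spanned by an isotropic family dual to a basis of [V]. The last clause, that
    [a] realises every functional induced on [V] by [B], is what yields surjectivity of the
    splitting. *)
Lemma isotropic_partner :
  exists (a : {vspace L}) (iota : 'Hom(dual (subvs_of a), V)),
    [/\ {in a &, forall x y, B x y = 0}, bijective iota,
        forall (t : subvs_of a) l, B (vsval t) (j (iota l)) = l t
      & forall x, exists t : subvs_of a, forall v, B (vsval t) (j v) = B x (j v)].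
Proof.
pose e := vbasis {:V}; pose c i : {linear V -> F^o} := coord e i.
have ce i (k : 'I_(\dim {:V})) : c i e`_k = (k == i)%:R :> F.
  by rewrite -(coord_free k i (basis_free (vbasisP {:V}))).
have cE v : v = \sum_i c i v *: e`_i by apply: coord_vbasis; apply: memvf.
have /fin_all_exists [s sE] i : exists x, forall v, B x (j v) = c i v.
  have [x xE] := nondegenerate_repr (linfun (c i \o p : L -> F^o)) B_nondeg.
  by exists x => v; rewrite xE lfunE /= jK.
(* The family s is dual to the basis e; subtracting half of its Gram matrix
   makes it isotropic without changing its pairing with e. *)
pose A i := s i - 2^-1 *: \sum_k B (s i) (s k) *: j e`_k.
have AJ i v : B (A i) (j v) = c i v.
  rewrite linearBl /= sE linearZl_LR linear_sumlz big1 ?mulr0 ?subr0 // => k _.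
  by rewrite linearZl_LR /= j_iso mulr0.
(* Each of the two corrections removes half of [B (s i) (s k)], and their mutual product vanishes by
   isotropy of the image of [j]. *)
have AA i k : B (A i) (A k) = 0.
  have sum_delta (G : 'I_(\dim {:V}) -> F) (n : 'I_(\dim {:V})) :
      \sum_m G m * (m == n)%:R = G n.
    rewrite (bigD1 n) //= eqxx mulr1 big1 ?addr0 // => m.
    by move=> /negPf ->; rewrite mulr0.
  have sA n : B (s n) (A k) = B (s n) (s k) - 2^-1 * B (s k) (s n).
    rewrite linearBr /= linearZr_LR linear_sumr.
    rewrite -[in RHS](sum_delta (fun m => B (s k) (s m))).
    by congr (_ - _ * _); apply: eq_bigr => m _; rewrite linearZr_LR /= sE ce.
  rewrite {1}/A linearBl /= sA linearZl_LR linear_sumlz.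
  under eq_bigr do rewrite linearZl_LR /= [B (j _) _]sym_formC AJ ce.
  by rewrite sum_delta [B (s k) _]sym_formC /=; field.
pose a := (\sum_i <[A i]>)%VS.
have aP x : x \in a -> exists k, x = \sum_i k i *: A i.
  case/memv_sumP => u uA ->.
  have /fin_all_exists [k kE] i : exists k, u i = k *: A i.
    by have /vlineP[k ->] := uA i isT; exists k.
  by exists k; apply: eq_bigr.
have Aa i : A i \in a by rewrite memvE (sumv_sup i).
(* The coordinates of [iota0 l] in the basis [e] are the values of [l] on the dual family [A]. *)
pose iota0 (l : dual (subvs_of a)) := \sum_i l (vsproj a (A i)) *: e`_i.
have lin : linear iota0.
  move=> k l m; rewrite /iota0 scaler_sumr -big_split; apply: eq_bigr => i _ /=.
  by rewrite add_lfunE scale_lfunE scalerDl scalerA.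
pose iota : 'Hom(dual (subvs_of a), V) := linfun (HB.pack iota0
  (GRing.isLinear.Build _ _ _ _ _ lin) : {linear _ -> _}).
have pair (t : subvs_of a) l : B (vsval t) (j (iota l)) = l t.
  have [k tE] := aP _ (subvsP t).
  have -> : t = \sum_i k i *: vsproj a (A i).
    by rewrite -[LHS]vsvalK tE linear_sum; apply: eq_bigr => i _; rewrite linearZ.
  rewrite linear_sum linear_sum linear_sumlz; apply: eq_bigr => i _.
  rewrite !linearZ linearZl_LR /= vsprojK // AJ lfunE /= /iota0 linear_sum.
  rewrite (bigD1 i) //= big1 ?addr0 => [|m /negPf im].
    by rewrite linearZ ce eqxx /= mulr1.
  by rewrite linearZ ce im /= mulr0.
exists a, iota; split=> //.
- move=> x y /aP[k ->] /aP[m ->]; rewrite linear_sumlz big1 // => i _.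
  rewrite linear_sumr big1 // => n _.
  by rewrite linearZl_LR linearZr_LR /= AA !mulr0.
(* The inverse of [iota] sends [v] to the functional [B (j v)] restricted to [a]. *)
- exists (fun v => (form_dual B (j v) \o linfun vsval)%VF) => [l | v].
    by apply/lfunP => t; rewrite comp_lfunE [linfun vsval t]lfunE form_dualE
      sym_formC pair.
  rewrite lfunE /= /iota0 [RHS]cE; apply: eq_bigr => i _.
  by rewrite comp_lfunE lfunE form_dualE sym_formC /= vsprojK // AJ.
move=> x; exists (vsproj a (\sum_(i < \dim {:V}) B x (j e`_i) *: A i)) => v.
rewrite vsprojK ?rpred_sum // => [|i _]; last by rewrite rpredZ.
rewrite [v in RHS]cE linear_sum linear_sumr linear_sumlz; apply: eq_bigr => i _.
by rewrite linearZ linearZr_LR linearZl_LR /= AJ mulrC.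
Qed.

Section Splitting.
Variables (a : {vspace L}) (iota : 'Hom(dual (subvs_of a), V)).
Hypothesis a_iso : {in a &, forall x y, B x y = 0}.
Hypothesis pair : forall (t : subvs_of a) l, B (vsval t) (j (iota l)) = l t.
Hypothesis partner :
  forall x, exists t : subvs_of a, forall v, B (vsval t) (j v) = B x (j v).

(** Taking the full orthogonal of [a] and the image of [j] makes [h] orthogonal to both by
    construction; that the three span [L] is left to [splitting_map_bijective]. *)
Let h := orthov B (a + limg (linfun j))%VS.

Let hP x : reflect ((forall y, y \in a -> B x y = 0) /\ forall v, B x (j v) = 0)
  (x \in h).
Proof.
apply: (iffP mem_orthovP) => [x0 | [xa xj] _ /memv_addP[y ya [_ /memv_imgP[v _ ->] ->]]].
  split=> [y ya | v]; first by apply/x0/(subvP (addvSl _ _)).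
  by apply/x0/(subvP (addvSr _ _)); rewrite -[j v]lfunE memv_img ?memvf.
by rewrite lfunE linearDr /= xa // xj addr0.
Qed.

Let ha (y : subvs_of h) (t : subvs_of a) : B (vsval y) (vsval t) = 0.
Proof. by have /hP[-> //] := subvsP y; apply: subvsP. Qed.
Let hj (y : subvs_of h) v : B (vsval y) (j v) = 0.
Proof. by have /hP[_ ->] := subvsP y. Qed.

Lemma splitting_map_isometry :
  isometry B (dce_form (form_pullback B vsval)) (splitting_map j h iota).
Proof.
move=> [[s x] l] [[t y] k]; rewrite /= /splitting_map /form_pullback /=.
rewrite !(linearDl, linearDr) /= a_iso ?subvsP // [B (vsval s) (vsval y)]sym_formC.
rewrite j_iso !ha !hj pair ![B (j _) (vsval _)]sym_formC pair !hj /dce_form /=; ring.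
Qed.

(** Pairing a vanishing sum with [a] kills its dual component and pairing it with the image of [j]
    kills its [a]-component, which gives injectivity. For surjectivity, a vector minus its
    components in [a] and in the image of [j] falls in [h]. *)
Lemma splitting_map_bijective : bijective (splitting_map j h iota).
Proof.
pose f := linfun (splitting_map j h iota).
have fE t : f t = splitting_map j h iota t by rewrite lfunE.
have inj0 t : splitting_map j h iota t = 0 -> t = 0.
  case: t => [[t y] l]; rewrite /splitting_map /= => t0.
  have l0 : l = 0.
    apply/lfunP => u; rewrite zero_lfunE -pair sym_formC.
    have := congr1 (fun x => B x (vsval u)) t0; rewrite linear0l !linearDl /=.
    by rewrite ha a_iso ?subvsP // !add0r.
  have t00 : t = 0.
    apply: dual_separates => k; rewrite -pair.
    have := congr1 (fun x => B x (j (iota k))) t0; rewrite linear0l !linearDl /=.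
    by rewrite hj j_iso !addr0.
  move: t0; rewrite l0 t00 !linear0 addr0 add0r => y0.
  by congr (_, _, _); apply: subvs_inj; rewrite y0 linear0.
have surj x : exists t, splitting_map j h iota t = x.
  have [t tE] := partner x.
  pose l : dual (subvs_of a) := (form_dual B x \o linfun vsval)%VF.
  (* Orthogonality to the image of [j] comes from the choice of [t], orthogonality to [a] from that
     of [l] together with the isotropy of [a]. *)
  have yh : x - vsval t - j (iota l) \in h.
    apply/hP; split=> [u ua | v]; rewrite !linearBl /=.
      rewrite [B (j _) u]sym_formC -(vsprojK ua) pair comp_lfunE lfunE form_dualE.
      by rewrite vsprojK // (a_iso (subvsP t)) // subr0 /= vsprojK // subrr.
    by rewrite tE j_iso subrr subr0.
  exists (t, vsproj h (x - vsval t - j (iota l)), l).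
  by rewrite /splitting_map /= vsprojK // addrA [_ + (x - _)]addrC !subrK.
have injf : lker f == 0%VS.
  by rewrite -subv0; apply/subvP => t; rewrite memv_ker memv0 fE => /eqP/inj0 ->.
exists (f^-1)%VF => [t | x]; first by rewrite -fE lker0_lfunK.
rewrite -fE limg_lfunVK //; have [t <-] := surj x.
by rewrite -fE memv_img ?memvf.
Qed.

End Splitting.

Lemma isotropic_splitting :
  exists (a h : {vspace L}) (iota : 'Hom(dual (subvs_of a), V)),
    [/\ bijective iota, bijective (splitting_map j h iota),
        isometry B (dce_form (form_pullback B vsval)) (splitting_map j h iota),
        forall (t : subvs_of a) l, B (vsval t) (j (iota l)) = l t
      & forall (y : subvs_of h) v, B (vsval y) (j v) = 0].
Proof.
have [a [iota [a_iso iota_bij pair partner]]] := isotropic_partner.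
exists a, (orthov B (a + limg (linfun j))%VS), iota; split=> //.
- exact: splitting_map_bijective.
- exact: splitting_map_isometry.
move=> y v; apply: (mem_orthovP (subvsP y)); apply: (subvP (addvSr _ _)).
by rewrite -[j v]lfunE memv_img ?memvf.
Qed.

End IsotropicComplement.

(** * Central extensions carrying an invariant metric *)

Section Extension.
Variables (F : fieldType) (g V : vectType F).
Variables (br : lie_bracket g) (theta : cocycle V br).
Variable BG : {symmetric (g * V)%type}.
Hypothesis BG_metric : invariant_metric (central_extension theta) BG.
Local Notation G := (g * V)%type.
Local Notation brG := (central_extension theta).
Local Notation K := (kernel_form BG : {symmetric V}).

Definition base_inj (x : g) : G := (x, 0).
Definition ker_inj (v : V) : G := (0, v).

Fact base_inj_linear : linear base_inj.
Proof. by move=> c x y; congr pair; rewrite /= scaler0 addr0. Qed.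
HB.instance Definition _ := GRing.isLinear.Build _ _ _ _ base_inj base_inj_linear.
Fact ker_inj_linear : linear ker_inj.
Proof. by move=> c x y; congr pair; rewrite /= scaler0 addr0. Qed.
HB.instance Definition _ := GRing.isLinear.Build _ _ _ _ ker_inj ker_inj_linear.

Let BGnd : nondegenerate BG := proj1 BG_metric.
Let BGinv x y z : BG x (brG y z) = BG (brG x y) z := proj2 BG_metric x y z.

Let pair_split (s : G) : s = base_inj s.1 + ker_inj s.2.
Proof. by case: s => x u; congr pair; rewrite /= ?addr0 ?add0r. Qed.

Let ker_inj_in v : ker_inj v \in ext_kernel g V.
Proof. by rewrite mem_ext_kernel. Qed.

Let in_ext_kernel s : s \in ext_kernel g V -> s = ker_inj s.2.
Proof.
rewrite mem_ext_kernel {2}(pair_split s) => /eqP ->.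
by rewrite linear0 add0r.
Qed.

(** Invariance moves the bracket onto the central vector [ker_inj v]. *)
Let bracket_ker s t v : BG (brG s t) (ker_inj v) = 0.
Proof.
rewrite -BGinv (_ : brG t (ker_inj v) = 0) ?linear0r //.
by rewrite /= /cext_fun /= !linear0r.
Qed.

(** The section [sigma] of the projection to [g] has values orthogonal to the kernel; brackets lie
    there too, so [sigma] is a morphism and [Bbar] is the pullback of [BG] along it. *)
Lemma nondegenerate_kernel_split :
  (ext_kernel g V :&: orthov BG (ext_kernel g V) = 0)%VS ->
  exists2 Bbar : {symmetric g}, invariant_metric br Bbar &
    exists f : G -> G, lie_isometry brG BG
      (dsum_bracket br (abelian_bracket V)) (dsum_form Bbar K) f.
Proof.
move=> V0; have Knd : nondegenerate K.
  apply/nondegenerateP => v v0.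
  suff : ker_inj v \in (ext_kernel g V :&: orthov BG (ext_kernel g V))%VS.
    by rewrite V0 memv0 => /eqP[].
  rewrite memv_cap ker_inj_in; apply/mem_orthovP => t /in_ext_kernel ->.
  exact: v0.
(* The adjoint of the inclusion of [V] is the orthogonal projection onto [V]. *)
have [w wE] := form_adjoint BG ker_inj Knd.
have Keq u v : (forall t, K u t = K v t) -> u = v.
  move=> e; apply/eqP; rewrite -subr_eq0; apply/eqP.
  by move/nondegenerateP: Knd; apply=> t; rewrite linearBl /= e subrr.
have wK v : w (ker_inj v) = v by apply: Keq => t; rewrite wE.
have w_br s t : w (brG s t) = 0.
  by apply: Keq => v; rewrite wE bracket_ker linear0l.
have [sigma sigmaE] : exists sigma : {linear g -> G},
    forall x, sigma x = base_inj x - ker_inj (w (base_inj x)).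
  by exists (base_inj \- ((ker_inj \o w) \o base_inj) : g -> G).
have sigma1 x : (sigma x).1 = x by rewrite sigmaE /= subr0.
have sigma_ker x v : BG (sigma x) (ker_inj v) = 0.
  by rewrite sigmaE linearBl /= -wE subrr.
have w_sigma x : w (sigma x) = 0.
  by apply: Keq => v; rewrite wE sigma_ker linear0l.
have ker_sigma x v : BG (ker_inj v) (sigma x) = 0 by rewrite sym_formC.
have split_w s : s = sigma s.1 + ker_inj (w s).
  have ws : w s = w (base_inj s.1) + s.2.
    by rewrite {1}(pair_split s) linearD /= wK.
  by rewrite ws sigmaE linearD /= addrA subrK -pair_split.
have sigma_br x y : sigma (br x y) = brG (sigma x) (sigma y).
  rewrite [RHS]split_w w_br linear0 addr0; congr (sigma _).
  by rewrite /= !sigma1.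
exists (form_pullback BG sigma).
  split=> [|x y z]; last by rewrite /= /form_pullback !sigma_br BGinv.
  apply/nondegenerateP => x x0.
  suff /(congr1 fst) : sigma x = 0 by rewrite sigma1.
  move/nondegenerateP: BGnd; apply=> t.
  by rewrite (split_w t) linearDr /= sigma_ker addr0; apply: x0.
exists (fun s => (s.1, w s)); split.
- by move=> c s t; congr pair; rewrite /= linearP.
- exists (fun s => sigma s.1 + ker_inj s.2) => [s | [x v]].
    by rewrite /= -split_w.
  congr pair; first by rewrite /= sigma1 addr0.
  by rewrite linearD /= wK w_sigma add0r.
- by move=> s t; rewrite w_br.
move=> s t; rewrite /= /dsum_form /= /form_pullback.
rewrite {3}(split_w s) {3}(split_w t) linearDl !linearDr.
by rewrite /= sigma_ker ker_sigma addr0 add0r.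
Qed.

(** * Isotropic kernels *)

Section Isotropic.
Hypothesis V_iso : (ext_kernel g V <= orthov BG (ext_kernel g V))%VS.

Let j_iso u v : BG (ker_inj u) (ker_inj v) = 0.
Proof. by move/orthovP: V_iso; apply; apply: ker_inj_in. Qed.

(** The map [T] represents through [Bg] the functional that [ker_inj v] induces on [g]. It is
    injective because [BG] is nondegenerate and [V] isotropic, and its values are central because
    brackets of the extension are orthogonal to [V]. *)
Lemma isotropic_kernel_dim (Bg : {symmetric g}) :
  invariant_metric br Bg -> (\dim {:V} <= \dim (lie_center br))%N.
Proof.
move=> [Bgnd Bginv]; have [w wE] := form_adjoint BG base_inj Bgnd.
pose T : 'Hom(V, g) := (w \o linfun ker_inj)%VF.
have TE v x : Bg (T v) x = BG (ker_inj v) (base_inj x).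
  by rewrite comp_lfunE lfunE wE.
have T0 : lker T == 0%VS.
  rewrite -subv0; apply/subvP => v; rewrite memv_ker memv0 => /eqP Tv0.
  suff /(congr1 snd) /= -> : ker_inj v = 0 by [].
  move/nondegenerateP: BGnd; apply=> s.
  by rewrite (pair_split s) linearDr /= j_iso -TE Tv0 linear0l addr0.
rewrite -(limg_dim_eq (U := fullv) (f := T)) ?(eqP T0) ?capv0 //.
apply: dimvS; apply/subvP => _ /memv_imgP[v _ ->]; apply/mem_lie_center => x.
move/nondegenerateP: Bgnd; apply=> y; rewrite -Bginv TE.
(* The two brackets differ by the cocycle value, which lies in [V] and is orthogonal to [V] by
   isotropy. *)
have -> : base_inj (br x y) = brG (base_inj x) (base_inj y) - ker_inj (theta x y).
  by congr pair; rewrite /= ?subr0 ?subrr.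
by rewrite linearBr /= j_iso subr0 sym_formC bracket_ker.
Qed.

Lemma isotropic_kernel_dce (Bg : {symmetric g}) (two_neq0 : 2 != 0 :> F) :
  invariant_metric br Bg ->
  exists a h : {vspace G},
    [/\ \dim h = (\dim {:g} - \dim {:V})%N, \dim a = \dim {:V},
        directv (a + h + ext_kernel g V)
          /\ (a + h + ext_kernel g V = fullv)%VS,
        exists (brh : lie_bracket (subvs_of h)) (Bh : {symmetric subvs_of h})
          (Bh_metric : invariant_metric brh Bh)
          (D : dce_data (subvs_of a) brh Bh)
          (iota : 'Hom(dual (subvs_of a), V)),
          bijective iota /\
          lie_isometry (double_central_extension D Bh_metric) (dce_form Bh)
            brG BG
            (fun t => vsval t.1.1 + vsval t.1.2 + (0, iota t.2))
      & exists (brah : lie_bracket (subvs_of a * subvs_of h)%type)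
          (Bah : {symmetric (subvs_of a * subvs_of h)%type}),
          [/\ invariant_metric brah Bah,
              lie_isometry brah Bah br Bg (fun t => (vsval t.1 + vsval t.2).1)
            & (derived_algebra br <= linfun (fst : G -> g) @: h)%VS]].
Proof.
move=> Bg_metric; have jK : cancel ker_inj snd by [].
have [a [h [iota [iota_bij f_bij f_iso pair hj]]]] :=
  isotropic_splitting two_neq0 jK BGnd j_iso.
set f := splitting_map ker_inj h iota in f_bij f_iso.
have fE t y l : f (t, y, l) = vsval t + vsval y + ker_inj (iota l) by [].
have f_surj x : exists (t : subvs_of a) (y : subvs_of h) l,
    x = vsval t + vsval y + ker_inj (iota l).
  by have [f' _ fK] := f_bij; case: (f' x) (fK x) => [[t y] l] <-; exists t, y, l.
have iota_surj v : exists l, v = iota l.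
  by have [iota' _ iotaK] := iota_bij; exists (iota' v).
have dim_a : \dim a = \dim {:V}.
  by rewrite [RHS]dimvf -(dim_bijective iota_bij) dim_dual.
have dim_h : (\dim a + \dim h + \dim a = \dim {:g} + \dim {:V})%N.
  rewrite !dimvf -[X in (_ + X = _)%N](dim_dual (subvs_of a)).
  exact: (dim_bijective f_bij).
have dim_full : \dim {:G} = (\dim {:g} + \dim {:V})%N by rewrite !dimvf.
exists a, h; split=> //.
(* Adding [\dim {:V}] to both terms of the truncated difference lets [dim_h] replace its first term
   by a sum that cancels exactly. *)
- by rewrite -[RHS](subnDr (\dim {:V})) -dim_h dim_a subnDr addKn.
- have sum_full : (a + h + ext_kernel g V = fullv)%VS.
    apply/eqP; rewrite eqEsubv subvf; apply/subvP => x _.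
    have [t [y [l ->]]] := f_surj x.
    by rewrite !memv_add ?subvsP.
  (* Since the sum is everything, directness follows once the dimensions of the summands add up to
     at most that of the whole space. *)
  split=> //; rewrite directvEgeq /= sum_full.
  have dim_ker : (\dim (ext_kernel g V) <= \dim {:V})%N.
    rewrite -(limg_ker_dim (linfun ker_inj) {:V}); apply: leq_trans (leq_addl _ _).
    apply/dimvS/subvP => s /in_ext_kernel ->.
    by rewrite -[ker_inj _]lfunE memv_img ?memvf.
  by rewrite dim_full -dim_h leq_add2l dim_a.
- have f_central l s : brG (f (0, 0, l)) s = 0.
    by rewrite fE !linear0 !add0r /= /cext_fun /= !linear0l.
  have [brh [Bh_metric [D D_iso]]] :=
    dce_of_isometry BG_metric f_bij f_iso f_central.
  by exists brh, (form_pullback BG vsval), Bh_metric, D, iota; split.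
(* Part (c): [k] is the projection to [g] restricted to [a + h], a complement of its kernel, so the
   structure of [g] can be pulled back along it. *)
pose k : {linear (subvs_of a * subvs_of h)%type -> g} :=
  (fst \o ((vsval \o fst) \+ (vsval \o snd))).
have kE t y : k (t, y) = (vsval t + vsval y).1 by [].
have k_bij : bijective k.
  have [f' fK f'K] := f_bij; exists (fun x => (f' (base_inj x)).1) => [[t y] | x].
    (* The choice of [l] cancels the [V]-component, so that [f (t, y, l)] lies in the copy of
       [g]. *)
    have [l lE] := iota_surj (- (vsval t + vsval y).2).
    have -> : base_inj (k (t, y)) = f (t, y, l).
      by rewrite fE -lE kE {2}(pair_split (vsval t + vsval y)) linearN /= addrK.
    by rewrite fK.
  case: (f' _) (f'K (base_inj x)) => [[t y] l] e.
  by rewrite kE -[RHS](congr1 fst e) /= addr0.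
have k_iso : isometry Bg (form_pullback Bg k) k by [].
have [brah [brah_metric brah_iso]] := lie_isometry_transport Bg_metric k_bij k_iso.
exists brah, (form_pullback Bg k); split=> //.
apply/derived_algebraP => x y.
have [t [z [l e]]] := f_surj (brG (base_inj x) (base_inj y)).
(* A bracket is orthogonal to [V], as are [h] and [V] itself, so its [a]-component pairs to zero
   with all of [V] and vanishes by duality. *)
have t0 : t = 0.
  apply: dual_separates => m; rewrite -pair.
  have := bracket_ker (base_inj x) (base_inj y) (iota m).
  by rewrite e !linearDl /= j_iso hj !addr0.
have -> : br x y = linfun fst (vsval z).
  by rewrite lfunE; have := congr1 fst e; rewrite t0 /= add0r addr0.
by rewrite memv_img ?subvsP.
Qed.
End Isotropic.
End Extension.

Theorem theorem3p3 (F : closedFieldType) (char0 : [pchar F] =i pred0)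
    (n r : nat) (g V : vectType F)
    (dim_g : \dim {:g} = n) (dim_V : \dim {:V} = r)
    (br : lie_bracket g) (Bg : {symmetric g})
    (Bg_metric : invariant_metric br Bg)
    (theta : cocycle V br) (BG : {symmetric (g * V)%type})
    (BG_metric : invariant_metric (central_extension theta) BG) :
  (* (i) *)
  ((ext_kernel g V :&: orthov BG (ext_kernel g V) = 0)%VS ->
    exists2 Bbar : {symmetric g}, invariant_metric br Bbar &
      exists f : g * V -> g * V,
        lie_isometry (central_extension theta) BG
          (dsum_bracket br (abelian_bracket V))
          (dsum_form Bbar (kernel_form BG)) f)
  /\
  (* (ii) *)
  ((ext_kernel g V <= orthov BG (ext_kernel g V))%VS ->
    (* (a) *)
    (r <= \dim (lie_center br))%N
    /\
    exists a h : {vspace g * V},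
      [/\ (* (b) *)
          \dim h = (n - r)%N, \dim a = r,
          directv (a + h + ext_kernel g V)
            /\ (a + h + ext_kernel g V = fullv)%VS,
          exists (brh : lie_bracket (subvs_of h)) (Bh : {symmetric subvs_of h})
            (Bh_metric : invariant_metric brh Bh)
            (D : dce_data (subvs_of a) brh Bh)
            (iota : 'Hom(dual (subvs_of a), V)),
            bijective iota /\
            lie_isometry (double_central_extension D Bh_metric) (dce_form Bh)
              (central_extension theta) BG
              (fun t => vsval t.1.1 + vsval t.1.2 + (0, iota t.2))
        & (* (c) *)
          exists (brah : lie_bracket (subvs_of a * subvs_of h)%type)
            (Bah : {symmetric (subvs_of a * subvs_of h)%type}),
            [/\ invariant_metric brah Bah,
                lie_isometry brah Bah br Bg
                  (fun t => (vsval t.1 + vsval t.2).1)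
              & (derived_algebra br <= linfun (fst : g * V -> g) @: h)%VS]]).
Proof.
(* Characteristic zero permits the halving that makes the complement [a] isotropic. *)
have two_neq0 : 2 != 0 :> F by rewrite (pcharf0P F).1.
split; first exact: nondegenerate_kernel_split.
move=> V_iso; rewrite -dim_g -dim_V; split.
  exact: (isotropic_kernel_dim BG_metric V_iso Bg_metric).
exact: (isotropic_kernel_dce BG_metric V_iso two_neq0 Bg_metric).
Qed.
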